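(* Let $\Phi$ be an irreducible crystallographic root system of a Weyl group and $\widetilde\Phi^+=\widehat\Phi$ the positive system of the corresponding affine root system. Let $\Psi^+$ be a positive system in $\Phi$, $\Pi$ its simple system, and $M\subset\Pi$. (i) If $L=\{\alpha\in\Pi : (\alpha,\mu)=0 \text{ for all }\mu\in M\}$ when $M\ne\emptyset$ (respectively $L=\Pi$ when $M=\emptyset$), then every biclosed set $\Gamma$ in $\widetilde\Phi^+$ with $I_\Gamma=\Psi^+_{L,M}$ is finitely generated. (ii) If $L\subsetneq\{\alpha\in\Pi : (\alpha,\mu)=0\text{ for all }\mu\in M\}$ when $M\neq\emptyset$ (respectively $L\subsetneq\Pi$ when $M=\emptyset$), then every biclosed set $\Gamma$ in $\widetilde\Phi^+$ with $I_\Gamma=\Psi^+_{L,M}$ is not finitely generated.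
   Context: Affine setting: $\Phi$ is finite and reduced, spanning a Euclidean space $V$ with inner product $(\cdot,\cdot)$; fix a (standard) positive system $\Phi^+$ of $\Phi$ and put $\Phi^-=-\Phi^+$. Let $V'=V\oplus\mathbb{R}\delta$, with the inner product extended by $(\delta,V')=0$. For $\alpha\in\Phi^+$ let $\widehat{\alpha}=\{\alpha+n\delta : n\in\mathbb{Z}_{\ge0}\}$; for $\alpha\in\Phi^-$ let $\widehat{\alpha}=\{\alpha+(n+1)\delta : n\in\mathbb{Z}_{\ge0}\}$; $\widetilde\Phi^+=\widehat{\Phi}=\bigcup_{\alpha\in\Phi}\widehat{\alpha}$. A set $\Gamma\subset\widetilde\Phi^+$ is closed if $\alpha,\beta\in\Gamma$, $k_1,k_2\in\mathbb{R}_{\ge0}$ and $k_1\alpha+k_2\beta\in\widetilde\Phi^+$ imply $k_1\alpha+k_2\beta\in\Gamma$; it is biclosed if both $\Gamma$ and $\widetilde\Phi^+\setminus\Gamma$ are closed. The closure of a subset is the smallest closed set containing it. A finitely generated biclosed set is a biclosed set equal to the closure of a finite set of roots. For $\Gamma\subset\widetilde\Phi^+$, $I_\Gamma=\{\alpha\in\Phi : |\widehat\alpha\cap\Gamma|=\aleph_0\}$. For orthogonal subsets $L,M\subset\Pi$ (i.e. $(\alpha,\beta)=0$ for all $\alpha\in L,\beta\in M$), $\Psi^+_{L,M}=(\Psi^+\setminus\Psi_L)\cup\Psi_M$, where $\Psi_L,\Psi_M$ are the root subsystems of $\Phi$ generated by $L$ and $M$. *)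

(* Defs.v *)
From HB Require Import structures.
From mathcomp Require Export all_boot all_order all_algebra.
From mathcomp Require Export sesquilinear finmap.
From mathcomp Require Export all_classical reals.

Set Implicit Arguments.
Unset Strict Implicit.
Unset Printing Implicit Defensive.

Import Order.TTheory GRing.Theory Num.Theory.
Local Open Scope classical_set_scope.
Local Open Scope ring_scope.

(* A Euclidean space is a finite-dimensional real vector space [V] together
   with a positive definite symmetric bilinear form [dot : {dot V for idfun}]. *)

Section FiniteRootSystem.
Variables (R : realType) (V : vectType R) (dot : {dot V for idfun}).
Implicit Types (Phi Psi Pi L M S : set V) (a b v : V).

Definition reflection a v : V := v - (2 * dot v a / dot a a) *: a.

Record root_system Phi : Prop := RootSystem {
  root_finite : finite_set Phi;
  root_span : <<fset_set Phi>>%VS = fullv;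
  root_neq0 : ~ Phi 0;
  root_reflection : forall a b, Phi a -> Phi b -> Phi (reflection a b);
  root_reduced : forall a (c : R), Phi a -> Phi (c *: a) -> c = 1 \/ c = -1
}.

Definition crystallographic Phi : Prop :=
  forall a b, Phi a -> Phi b -> 2 * dot b a / dot a a \is a Num.int.

Definition orthogonal_sets L M : Prop :=
  forall a b, L a -> M b -> dot a b = 0.

Definition irreducible Phi : Prop :=
  Phi !=set0 /\
  forall S1 S2, Phi = S1 `|` S2 -> orthogonal_sets S1 S2 ->
    S1 = set0 \/ S2 = set0.

Definition positive_system Phi Psi : Prop :=
  exists v, (forall a, Phi a -> dot v a != 0) /\
            Psi = [set a | Phi a /\ 0 < dot v a].

(* For [Psi] a positive system. *)
Definition simple_system Psi Pi : Prop :=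
  [/\ Pi `<=` Psi, free (fset_set Pi) &
      forall a, Psi a -> exists2 c : V -> R,
        forall b, 0 <= c b & a = \sum_(b <- fset_set Pi) c b *: b].

Definition root_subsystem Phi S : Prop :=
  S `<=` Phi /\ forall a b, S a -> S b -> S (reflection a b).

Definition generated_subsystem Phi L : set V := smallest (root_subsystem Phi) L.

(* [Psi] is the positive system written Psi^+, so this is Psi^+_{L,M}. *)
Definition positive_LM Phi Psi L M : set V :=
  (Psi `\` generated_subsystem Phi L) `|` generated_subsystem Phi M.

(* When [M] is empty this is [Pi]. *)
Definition simple_perp Pi M : set V :=
  [set a | Pi a /\ forall mu, M mu -> dot a mu = 0].

End FiniteRootSystem.

Section AffineRootSystem.
Variables (R : realType) (V : vectType R).
Implicit Types (Phi Phip : set V) (Gamma A : set (V * R^o)).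

(* V' = V + R delta is the product [V * R^o]. *)
Definition delta : V * R^o := (0, 1).
Definition embV (a : V) : V * R^o := (a, 0).

Definition hat Phip (a : V) : set (V * R^o) :=
  [set x | exists n : nat,
     Phip a /\ x = embV a + n%:R *: delta \/
     Phip (- a) /\ x = embV a + n.+1%:R *: delta].

Definition affine_positive Phi Phip : set (V * R^o) :=
  \bigcup_(a in Phi) hat Phip a.

Definition affine_closed Phi Phip Gamma : Prop :=
  Gamma `<=` affine_positive Phi Phip /\
  forall x y (k1 k2 : R), Gamma x -> Gamma y -> 0 <= k1 -> 0 <= k2 ->
    affine_positive Phi Phip (k1 *: x + k2 *: y) ->
    Gamma (k1 *: x + k2 *: y).

Definition biclosed Phi Phip Gamma : Prop :=
  affine_closed Phi Phip Gamma /\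
  affine_closed Phi Phip (affine_positive Phi Phip `\` Gamma).

Definition affine_closure Phi Phip A : set (V * R^o) :=
  smallest (affine_closed Phi Phip) A.

Definition finitely_generated Phi Phip Gamma : Prop :=
  exists A, [/\ finite_set A, A `<=` affine_positive Phi Phip &
                Gamma = affine_closure Phi Phip A].

(* Written I_Gamma. *)
Definition infinite_roots Phi Phip Gamma : set V :=
  [set a | Phi a /\ ((hat Phip a `&` Gamma) #= [set: nat])%card].

End AffineRootSystem.

(* Main.v *)
From mathcomp Require Import lra ring.
Require Import Defs.

(* Write deg for the sum of the simple coordinates outside the union of L and
   M. Looking at the infinite dihedral subsystem spanned by a, -a and delta, one
   finds that a biclosed Gamma with I_Gamma = Psi^+_{L,M} contains the whole
   string of every root a with deg a > 0, and nothing of the string of -a.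

   If L is the full orthogonal of M in Pi, finitely many roots generate
   arbitrarily high levels of each such string: when a is not orthogonal to
   some mu in M, add a multiple of a high level of mu or -mu to the reflection
   of a in mu; otherwise a multiple of a is a nonnegative integer combination
   of two roots of positive degree, the first of which is not orthogonal to M.

   If a simple root beta orthogonal to M is missing from L, the roots of the
   subsystem generated by L and beta met by Gamma lie in an open half-space. A
   large multiple of the corresponding linear form bounds the levels of any
   finite subset of Gamma; this bound is inherited by the closure, and it
   excludes the high levels of beta. *)

Set Implicit Arguments.
Unset Strict Implicit.
Unset Printing Implicit Defensive.
Import Order.TTheory GRing.Theory Num.Theory.
Local Open Scope classical_set_scope.
Local Open Scope ring_scope.

(** The involution [r] sends each negative term to a positive one that cancels it. The terms left
    over are nonnegative, and that of [i] is among them because [r i] is outside [s]. *)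
Lemma sumr_gt0_antisymmetric (F : realDomainType) (I : eqType) (s : seq I)
    (f : I -> F) (r : I -> I) (i : I) :
  uniq s -> involutive r -> (forall j, f (r j) = - f j) ->
  (forall j, j \in s -> f j < 0 -> r j \in s) ->
  i \in s -> r i \notin s -> 0 < f i ->
  0 < \sum_(j <- s) f j.
Proof.
move=> us rK fr neg_s si ri fi.
rewrite (bigID (fun j => f j < 0)) /= -big_filter -[X in _ + X]big_filter.
set N := [seq j <- s | _]; set N' := [seq j <- s | _].
have -> : \sum_(j <- N) f j = - \sum_(j <- [seq r j | j <- N]) f j.
  by rewrite big_map -sumrN; apply: eq_bigr => j _; rewrite fr opprK.
have pN : perm_eq [seq r j | j <- N] [seq j <- N' | r j \in N].
  apply: uniq_perm => [||j].
  - by rewrite map_inj_uniq ?filter_uniq //; exact: inv_inj.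
  - by rewrite !filter_uniq.
  rewrite mem_filter -{1}[j]rK mem_map; last exact: inv_inj.
  case: (boolP (r j \in N)) => //=; rewrite !mem_filter => /andP[rj0 rjs].
  by rewrite -leNgt -{2}[j]rK neg_s // andbT -oppr_le0 -fr ltW.
rewrite addrC subr_gt0 (perm_big _ pN) /= big_filter.
rewrite [ltRHS](bigID (fun j => r j \in N)) /= ltrDl.
rewrite -big_filter (bigD1_seq i) /=; last by rewrite !filter_uniq.
  rewrite ltr_pwDl // big_seq_cond sumr_ge0 // => j.
  by rewrite !mem_filter -leNgt => /andP[/andP[_ /andP[]]].
by rewrite !mem_filter si -leNgt ltW // (negPf ri) andbF.
Qed.

(** * Reflections in a Euclidean space *)

Section Reflections.
Variables (R : realType) (V : vectType R) (dot : {dot V for idfun}).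
Implicit Types (a b u w : V).

Lemma dotC u w : dot u w = dot w u.
Proof. by rewrite hermC expr0 mul1r. Qed.

Lemma dot_gt0 u : u != 0 -> 0 < dot u u.
Proof. exact: neq0_dnorm_gt0. Qed.

Lemma dot_self_eq0 u : dot u u = 0 -> u = 0.
Proof. by apply: contraPP => /eqP /dot_gt0 /lt0r_neq0 /eqP. Qed.

Lemma dotZl (k : R) u w : dot (k *: u) w = k * dot u w.
Proof. exact: linearZl_LR. Qed.

Lemma dotDl u1 u2 w : dot (u1 + u2) w = dot u1 w + dot u2 w.
Proof. exact: linearDl. Qed.

Lemma dotZr (k : R) u w : dot u (k *: w) = k * dot u w.
Proof. by rewrite dotC dotZl dotC. Qed.

Lemma dot_reflection a u w :
  dot (reflection dot a u) w = dot u w - 2 * dot u a / dot a a * dot a w.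
Proof. by rewrite /reflection linearBl /= dotZl. Qed.

Lemma reflection_linear a (k : R) u w :
  reflection dot a (k *: u + w) = k *: reflection dot a u + reflection dot a w.
Proof.
rewrite /reflection dotDl dotZl scalerBr scalerA addrACA -opprD -scalerDl.
by congr (_ - _ *: _); ring.
Qed.

Lemma reflectionD a u w :
  reflection dot a (u + w) = reflection dot a u + reflection dot a w.
Proof. by rewrite -[u]scale1r reflection_linear !scale1r. Qed.

Lemma reflection_id a u : dot u a = 0 -> reflection dot a u = u.
Proof. by rewrite /reflection => ->; rewrite mulr0 mul0r scale0r subr0. Qed.

Lemma reflectionZ a (k : R) u :
  reflection dot a (k *: u) = k *: reflection dot a u.
Proof.
by rewrite -[k *: u]addr0 reflection_linear [reflection _ _ 0]reflection_id
  ?addr0 ?linear0l.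
Qed.

Lemma dot_reflection_root a u : a != 0 ->
  dot (reflection dot a u) a = - dot u a.
Proof. by move=> /dot_gt0 a0; rewrite dot_reflection; field; lra. Qed.

Lemma reflectionK a : a != 0 -> involutive (reflection dot a).
Proof.
move=> a0 u; rewrite [LHS]/reflection dot_reflection_root //.
by rewrite /reflection mulrN mulNr scaleNr opprK subrK.
Qed.

Lemma reflection_self a : a != 0 -> reflection dot a a = - a.
Proof.
move=> /dot_gt0 a0; rewrite /reflection mulfK ?gt_eqF //.
by rewrite scaler_nat mulr2n opprD addrA subrr sub0r.
Qed.

End Reflections.

(** * Root systems and generated subsystems *)

Section RootSystems.
Variables (R : realType) (V : vectType R) (dot : {dot V for idfun}).
Variables (Phi : set V) (rsPhi : root_system dot Phi).
Implicit Types (a b g u w : V) (S T : set V).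

Lemma rootN0 a : Phi a -> a != 0.
Proof. by move=> Pa; apply: contra_notN (root_neq0 rsPhi) => /eqP <-. Qed.

Lemma root_opp a : Phi a -> Phi (- a).
Proof.
move=> Pa; rewrite -(reflection_self dot (rootN0 Pa)).
exact: root_reflection.
Qed.

Lemma root_subsystem_opp S a : root_subsystem dot Phi S -> S a -> S (- a).
Proof.
move=> [SP Sr] Sa; rewrite -(reflection_self dot (rootN0 (SP _ Sa))).
exact: Sr.
Qed.

Lemma generated_root_subsystem S : S `<=` Phi ->
  root_subsystem dot Phi (generated_subsystem dot Phi S).
Proof.
move=> SP; split.
  by apply: smallest_sub SP; split=> // a b; exact: root_reflection.
move=> a b Ga Gb T ST; have [[_ rT] _] := ST.
by apply: rT; [exact: (Ga T ST)|exact: (Gb T ST)].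
Qed.

Lemma generated_subsystem_dot0 S u : (forall a, S a -> dot a u = 0) ->
  S `<=` Phi -> forall g, generated_subsystem dot Phi S g -> dot g u = 0.
Proof.
move=> Su SP g gS.
pose T := [set b | Phi b /\ dot b u = 0].
suff: T g by case.
apply: smallest_sub gS; last by move=> b Sb; split; [exact: SP|exact: Su].
split=> [b []//|a b [Pa au] [Pb bu]]; split; first exact: root_reflection.
by rewrite dot_reflection au bu mulr0 subr0.
Qed.

Lemma generated_subsystem_orthogonal S T : S `<=` Phi -> T `<=` Phi ->
  orthogonal_sets dot S T ->
  orthogonal_sets dot (generated_subsystem dot Phi S)
    (generated_subsystem dot Phi T).
Proof.
move=> SP TP ST a b Sa Tb; rewrite dotC.
apply: (generated_subsystem_dot0 _ TP Tb) => t Tt; rewrite dotC.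
by apply: (generated_subsystem_dot0 _ SP Sa) => s Ss; exact: ST.
Qed.

Lemma generated_subsystem_mono S T : S `<=` T ->
  generated_subsystem dot Phi S `<=` generated_subsystem dot Phi T.
Proof.
move=> ST a Sa U [rU TU]; apply: Sa; split=> //.
exact: subset_trans TU.
Qed.

(* The sum of [P] works: if [q] contributes negatively to the pairing with
   [g], then [reflection g q] lies in [P] and cancels it, and [g] itself is not
   cancelled because [- g] is not in [P]. *)
Lemma dot_pos_sum (P : set V) : P `<=` Phi ->
  (forall g, P g -> ~ P (- g)) ->
  (forall g q, P g -> P q -> dot q g < 0 -> P (reflection dot g q)) ->
  exists v, forall g, P g -> 0 < dot g v.
Proof.
move=> PP Popp Prefl.
have finP : finite_set P := sub_finite_set PP (root_finite rsPhi).
exists (\sum_(q <- fset_set P) q) => g Pg.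
have g0 := rootN0 (PP _ Pg).
rewrite linear_sumr /=.
apply: (@sumr_gt0_antisymmetric _ _ _ _ (reflection dot g) g).
- exact: fset_uniq.
- exact: reflectionK.
- by move=> q; rewrite dotC dot_reflection_root // dotC.
- move=> q; rewrite !in_fset_set // => /set_mem Pq; rewrite dotC => qg.
  by apply/mem_set/Prefl.
- by rewrite in_fset_set //; exact/mem_set.
- rewrite reflection_self // in_fset_set //; apply/negP => /set_mem.
  exact: Popp.
- exact: dot_gt0.
Qed.

End RootSystems.

(** * Positive systems *)

Section PositiveSystems.
Variables (R : realType) (V : vectType R) (dot : {dot V for idfun}).
Variables (Phi : set V) (rsPhi : root_system dot Phi).
Variables (Psi : set V) (psPsi : positive_system dot Phi Psi).
Implicit Types (a b : V).

Lemma positive_sub a : Psi a -> Phi a.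
Proof. by case: psPsi => v [_ ->] []. Qed.

Lemma positive_or_opp a : Phi a -> Psi a \/ Psi (- a).
Proof.
case: psPsi => v [nv ->] Pa.
have := nv a Pa; rewrite neq_lt => /orP[av|av]; [right|left] => //.
by split; [exact: (root_opp rsPhi)|rewrite linearNr oppr_gt0].
Qed.

Lemma positive_not_opp a : Psi a -> ~ Psi (- a).
Proof.
case: psPsi => v [_ ->] [_ va] [_]; rewrite linearNr oppr_gt0.
by rewrite ltNge ltW.
Qed.

(** A root with coefficient zero may have either sign, as needed for affine combinations of level
    zero. The pairing with a regular vector is nonnegative on the combination and cannot vanish on a
    root. *)
Lemma positive_cone a b (k1 k2 : R) : 0 <= k1 -> 0 <= k2 ->
  Phi (k1 *: a + k2 *: b) -> (k1 = 0 \/ Psi a) -> (k2 = 0 \/ Psi b) ->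
  Psi (k1 *: a + k2 *: b).
Proof.
move: (psPsi) => [v [nv PsiE]] k1_ge0 k2_ge0 Pab ka kb.
have nneg (c : R) u : 0 <= c -> c = 0 \/ Psi u -> 0 <= c * dot v u.
  move=> c0 [->|]; first by rewrite mul0r.
  by rewrite PsiE => -[_ /ltW]; exact: mulr_ge0.
rewrite PsiE; split=> //.
rewrite lt_neqAle eq_sym nv //= dotC dotDl !dotZl !(dotC _ _ v).
by rewrite addr_ge0 ?nneg.
Qed.

End PositiveSystems.

(** * Simple systems and heights *)

Section SimpleSystems.
Variables (R : realType) (V : vectType R) (dot : {dot V for idfun}).
Variables (Phi : set V) (rsPhi : root_system dot Phi).
Variables (Psi : set V) (psPsi : positive_system dot Phi Psi).
Variables (Pi : set V) (ssPi : simple_system Psi Pi).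
Implicit Types (a b g x : V) (S T : set V).

Lemma simple_root a : Pi a -> Phi a.
Proof. by case: ssPi => PiPsi _ _ /PiPsi /(positive_sub psPsi). Qed.

Let finPi : finite_set Pi := sub_finite_set simple_root (root_finite rsPhi).

(** The height with the simple roots in [S] disregarded; [coord] makes it linear on the whole
    space. *)
Definition outer_degree S x : R :=
  \sum_(i < #|`fset_set Pi| | (fset_set Pi)`_i \notin S)
    coord (in_tuple (fset_set Pi)) i x.

Lemma outer_degreeD S x y :
  outer_degree S (x + y) = outer_degree S x + outer_degree S y.
Proof.
by rewrite -[RHS]big_split; apply: eq_bigr => i _; rewrite linearD.
Qed.

Lemma outer_degreeZ S (k : R) x :
  outer_degree S (k *: x) = k * outer_degree S x.
Proof.
by rewrite /outer_degree mulr_sumr; apply: eq_bigr => i _; rewrite linearZ.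
Qed.

Lemma outer_degreeN S x : outer_degree S (- x) = - outer_degree S x.
Proof. by rewrite -scaleN1r outer_degreeZ mulN1r. Qed.

Lemma outer_degree_reflection S a x : outer_degree S (reflection dot a x) =
  outer_degree S x - 2 * dot x a / dot a a * outer_degree S a.
Proof. by rewrite outer_degreeD outer_degreeN outer_degreeZ. Qed.

Lemma outer_degree_simple S b : Pi b -> outer_degree S b = (b \notin S)%:R.
Proof.
case: ssPi => _ freePi _ Pib.
have bPi : b \in (fset_set Pi : seq V) by rewrite in_fset_set //; exact/mem_set.
have jP : (index b (fset_set Pi) < #|`fset_set Pi|)%N by rewrite index_mem.
pose j := Ordinal jP.
have bE : b = (in_tuple (fset_set Pi))`_j by rewrite nth_index.
rewrite /outer_degree; case: (boolP (b \notin S)) => bS.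
  rewrite (bigD1 j) /= -?bE // {1}bE coord_free // eqxx big1 ?addr0 // => i.
  by move=> /andP[_ ij]; rewrite bE coord_free // eq_sym (negPf ij).
rewrite big1 // => i iS; rewrite bE coord_free //.
by case: eqP => // ji; move: iS; rewrite -ji -bE (negPf bS).
Qed.

(** The coordinates of a positive root are nonnegative, so a vanishing outer degree kills each of
    them outside [S]. One [c] serves for all [S]. *)
Lemma positive_outer_degree a : Psi a -> exists c : V -> R,
  [/\ forall b, 0 <= c b, a = \sum_(b <- fset_set Pi) c b *: b,
      forall S, 0 <= outer_degree S a &
      forall S b, Pi b -> outer_degree S a = 0 -> 0 < c b -> S b].
Proof.
case: ssPi => _ _ Pispan /Pispan[c c0 aE]; exists c.
have degE S : outer_degree S a = \sum_(b <- fset_set Pi) c b * (b \notin S)%:R.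
  rewrite aE (big_morph (outer_degree S) (outer_degreeD S) (id1 := 0)).
    rewrite big_seq [RHS]big_seq; apply: eq_bigr => b.
    rewrite in_fset_set // => /set_mem Pib.
    by rewrite outer_degreeZ outer_degree_simple.
  by rewrite -(scale0r 0) outer_degreeZ mul0r.
have ge0 S b : 0 <= c b * (b \notin S)%:R by rewrite mulr_ge0.
split=> // [S|S b Pib]; first by rewrite degE sumr_ge0.
rewrite degE => /eqP; rewrite psumr_eq0 // => /allP /(_ b).
rewrite in_fset_set // mem_set //= => /(_ isT) cb b0; apply/set_mem.
by move: cb; rewrite mulf_eq0 gt_eqF //= pnatr_eq0 eqb0 negbK.
Qed.

Lemma outer_degree_ge0 S a : Psi a -> 0 <= outer_degree S a.
Proof. by move=> /positive_outer_degree[c []]. Qed.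

Lemma outer_degree_gt0 S a : Phi a -> 0 < outer_degree S a -> Psi a.
Proof.
move=> Pa a0; have [//|/(outer_degree_ge0 S)] := positive_or_opp rsPhi psPsi Pa.
by rewrite outer_degreeN oppr_ge0 leNgt a0.
Qed.

Lemma outer_degree1_eq0 a g : Pi a -> Psi g -> outer_degree [set a] g = 0 ->
  g = a.
Proof.
move=> Pia Psig; have [c [c0 gE _ cS]] := positive_outer_degree Psig => g0.
have {}gE : g = c a *: a.
  have aPi : a \in (fset_set Pi : seq V).
    by rewrite in_fset_set //; exact/mem_set.
  rewrite gE (bigD1_seq a) ?fset_uniq //= big1_seq ?addr0 // => b.
  rewrite in_fset_set // => /andP[ba /set_mem Pib].
  have := c0 b; rewrite le_eqVlt => /predU1P[<-|/(cS _ _ Pib g0) /= ab].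
    by rewrite scale0r.
  by rewrite ab eqxx in ba.
have := root_reduced rsPhi (simple_root Pia); move=> /(_ (c a)).
rewrite -gE => /(_ (positive_sub psPsi Psig)) [] ca; move: gE; rewrite ca.
  by rewrite scale1r.
by have := c0 a; rewrite ca ler0N1.
Qed.

(** Reflection in [a] changes only the coordinate at [a], and a positive root other than [a] has
    another positive coordinate, which survives. *)
Lemma positive_reflection a g : Pi a -> Psi g -> g <> a ->
  Psi (reflection dot a g).
Proof.
move=> Pia Psig ga.
apply: (@outer_degree_gt0 [set a]).
  apply: (root_reflection rsPhi); first exact: simple_root.
  exact: (positive_sub psPsi).
rewrite outer_degree_reflection (outer_degree_simple _ Pia).
rewrite mem_set //= mulr0 subr0.
rewrite lt_neqAle outer_degree_ge0 // andbT eq_sym; apply/eqP.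
by move=> /(outer_degree1_eq0 Pia Psig).
Qed.

(** Descent by simple reflections. The condition over all [S] records that [a] is in the support of
    [g], so that the descent can be confined to a given set of simple roots. *)
Lemma simple_ind (P : V -> Prop) :
  (forall a, Pi a -> P a) ->
  (forall a g, Pi a -> Psi g -> g <> a -> Psi (reflection dot a g) ->
     0 < dot g a -> (forall S, outer_degree S g = 0 -> S a) ->
     P (reflection dot a g) -> P g) ->
  forall g, Psi g -> P g.
Proof.
have [v [_ PsiE]] := psPsi.
have [PiPsi _ _] := ssPi.
move=> Psimple Pstep.
(* The measure counts the roots whose pairing with the regular vector [v] is below that of [g]; the
   reflection used lowers this pairing. *)
pose m g := #|` [fset b in fset_set Phi | dot v b < dot v g]%fset|.
suff PI n g : (m g < n)%N -> Psi g -> P g by move=> g; exact: (PI (m g).+1).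
elim: n g => // n IH g mg Psig.
have [c [c0 gE _ cS]] := positive_outer_degree Psig.
have g0 : g != 0.
  apply: contra_notN (root_neq0 rsPhi) => /eqP <-.
  exact: (positive_sub psPsi).
(* Since (g, g) > 0 is the sum of the c b (g, b), some term is positive. *)
have [a [Pia ca ga]] : exists a, [/\ Pi a, 0 < c a & 0 < dot g a].
  apply: contrapT => nex; have := dot_gt0 dot g0.
  rewrite {2}gE linear_sumr /= ltNge big_seq sumr_le0 // => b.
  rewrite in_fset_set // => /set_mem Pib.
  rewrite dotZr; have := c0 b; rewrite le_eqVlt => /predU1P[<-|cb].
    by rewrite mul0r.
  rewrite pmulr_rle0 // leNgt; apply/negP => gb; apply: nex.
  by exists b.
have [->|/eqP nga] := eqVneq g a; first exact: Psimple.
have Psir := positive_reflection Pia Psig nga.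
apply: (Pstep a) => //.
  by move=> S gS; exact: (cS S).
have rg : dot v (reflection dot a g) < dot v g.
  have va : 0 < dot v a by have := PiPsi _ Pia; rewrite PsiE => -[].
  rewrite dotC dot_reflection (dotC _ a) dotC gtrBl mulr_gt0 ?divr_gt0 //.
    by rewrite mulr_gt0.
  exact/dot_gt0/(rootN0 rsPhi)/simple_root.
have finPhi := root_finite rsPhi.
apply: IH => //; apply: (@leq_trans (m g)) => //.
apply: fproper_ltn_card; rewrite fproperE; apply/andP; split.
  apply/fsubsetP => b; rewrite !inE => /andP[-> /=] /lt_trans; exact.
apply/fsubsetPn; exists (reflection dot a g).
  rewrite !inE rg andbT in_fset_set // mem_set //.
  exact: (positive_sub psPsi).
by rewrite !inE ltxx andbF.
Qed.

Lemma generated_outer_degree S T g : S `<=` Pi -> S `<=` T ->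
  generated_subsystem dot Phi S g -> outer_degree T g = 0.
Proof.
move=> SPi ST gS; pose U := [set b | Phi b /\ outer_degree T b = 0].
suff: U g by case.
apply: smallest_sub gS.
  split=> [b []//|a b [Pa a0] [Pb b0]]; split; first exact: root_reflection.
  by rewrite outer_degree_reflection a0 b0 mulr0 subr0.
move=> a Sa; split; first exact/simple_root/SPi.
by rewrite outer_degree_simple ?mem_set //=; [exact: ST|exact: SPi].
Qed.

(** The descent uses only simple roots of [S] and [T]. Each reflection preserves the subsystem of
    its own side and fixes the other one pointwise, so the two never mix. *)
Lemma generated_of_outer_degree0 S T g : S `<=` Pi -> T `<=` Pi ->
  orthogonal_sets dot S T -> Phi g -> outer_degree (S `|` T) g = 0 ->
  generated_subsystem dot Phi S g \/ generated_subsystem dot Phi T g.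
Proof.
move=> SPi TPi ST Pg; wlog Psig : g Pg / Psi g => [wlg g0|].
  have [Psig|Psig] := positive_or_opp rsPhi psPsi Pg; first exact: wlg.
  have := wlg _ (root_opp rsPhi Pg) Psig.
  rewrite outer_degreeN g0 oppr0 => /(_ erefl).
  have GN U : U `<=` Pi -> generated_subsystem dot Phi U (- g) ->
      generated_subsystem dot Phi U g.
    move=> UPi /(root_subsystem_opp rsPhi); rewrite opprK; apply.
    exact/(generated_root_subsystem rsPhi)/(subset_trans UPi)/simple_root.
  by case=> /GN; [left|right]; auto.
have SP : S `<=` Phi := subset_trans SPi simple_root.
have TP : T `<=` Phi := subset_trans TPi simple_root.
have [_ refS] := generated_root_subsystem rsPhi SP.
have [_ refT] := generated_root_subsystem rsPhi TP.
have genS : S `<=` generated_subsystem dot Phi S by exact: sub_smallest.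
have genT : T `<=` generated_subsystem dot Phi T by exact: sub_smallest.
have GST := generated_subsystem_orthogonal rsPhi SP TP ST.
elim/simple_ind: g / Psig Pg => [a Pia _|a g Pia Psig _ Psir _ gS IH _ g0].
  rewrite outer_degree_simple //.
  case: (boolP (a \in _)) => [/set_mem [] aG _|_ /eqP].
  - by left; exact: genS.
  - by right; exact: genT.
  - by rewrite oner_eq0.
have Pr := positive_sub psPsi Psir.
have aN0 := rootN0 rsPhi (simple_root Pia).
have aST := gS _ g0.
have r0 : outer_degree (S `|` T) (reflection dot a g) = 0.
  rewrite outer_degree_reflection g0 outer_degree_simple // mem_set //=.
  by rewrite mulr0 subr0.
rewrite -[g](reflectionK dot aN0).
have [] := IH Pr r0; case: aST => aG rG.
- by left; apply: refS rG; exact: genS.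
- rewrite [reflection _ _ (reflection _ _ _)]reflection_id; first by left.
  by rewrite GST //; exact: genT.
- rewrite [reflection _ _ (reflection _ _ _)]reflection_id; first by right.
  by rewrite dotC GST //; exact: genS.
- by right; apply: refT rG; exact: genT.
Qed.

(** * Cartan integers and decompositions of roots *)

Hypothesis crPhi : crystallographic dot Phi.

Lemma cartan_nat a b : Phi a -> Phi b -> 0 < dot b a ->
  exists2 n : nat, (0 < n)%N & 2 * dot b a / dot a a = n%:R.
Proof.
move=> Pa Pb ba; have := crPhi Pa Pb.
have c0 : 0 < 2 * dot b a / dot a a.
  by rewrite divr_gt0 ?mulr_gt0 ?dot_gt0 ?(rootN0 rsPhi).
rewrite intrEge0 ?ltW // => /natrP[n nE].
by exists n => //; rewrite -(ltr0n R) -nE.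
Qed.

(* Induction along simple reflections. For a simple root [a] with
   [0 < dot g a], reflecting in [a] preserves the claim when [a] is in [L], and
   [a] cannot be in [M]. Otherwise [g = n a + reflection a g]; the only problem
   is [b := reflection a g] generated by [M], in which case orthogonality of [g]
   and [b] gives [d g = a + reflection b a], [d] a Cartan integer. *)
Lemma orthogonal_root_decomposition (L M : set V) g :
  L `<=` Pi -> M `<=` Pi -> orthogonal_sets dot L M ->
  (forall a, Pi a -> ~ L a -> ~ M a -> exists2 mu, M mu & dot a mu != 0) ->
  Psi g -> 0 < outer_degree (L `|` M) g -> (forall mu, M mu -> dot g mu = 0) ->
  exists g1 g2 (d c1 c2 : nat),
    [/\ Phi g1, 0 < outer_degree (L `|` M) g1 &
        exists2 mu, M mu & dot g1 mu != 0] /\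
    [/\ Phi g2, 0 < outer_degree (L `|` M) g2, (0 < d)%N, (0 < c1)%N &
        d%:R *: g = c1%:R *: g1 + c2%:R *: g2].
Proof.
move=> LPi MPi LM perpL Psig.
set deg := outer_degree (L `|` M).
have LP : L `<=` Phi := subset_trans LPi simple_root.
have MP : M `<=` Phi := subset_trans MPi simple_root.
elim/simple_ind: g / Psig => [a Pia|a g Pia Psig _ Psir ga _ IH].
  rewrite /deg outer_degree_simple // ltr0n lt0b => /negP aLM a0; exfalso.
  have [mu Mmu] : exists2 mu, M mu & dot a mu != 0.
    by apply: perpL => // aS; apply/aLM/mem_set; [left|right].
  by rewrite a0 ?eqxx.
move=> dg0 g0.
have Pa := simple_root Pia; have aN0 := rootN0 rsPhi Pa.
have Pg := positive_sub psPsi Psig.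
have [Ma|Ma] := pselect (M a); first by rewrite g0 ?ltxx in ga.
(* For [a] in [L] the reflection preserves [deg] and the pairings with [M], so it carries a
   decomposition of the reflected root back to [g]. *)
have [La|La] := pselect (L a).
  have amu mu : M mu -> dot a mu = 0 by exact: LM.
  have deg_r x : deg (reflection dot a x) = deg x.
    rewrite /deg outer_degree_reflection (outer_degree_simple _ Pia) mem_set /=.
      by rewrite mulr0 subr0.
    by left.
  have dot_r x mu : M mu -> dot (reflection dot a x) mu = dot x mu.
    by move=> Mmu; rewrite dot_reflection (amu mu) // mulr0 subr0.
  have r0 mu : M mu -> dot (reflection dot a g) mu = 0.
    by move=> Mmu; rewrite dot_r // g0.
  have := IH; rewrite deg_r => /(_ dg0 r0)[g1 [g2 [d [c1 [c2]]]]].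
  move=> [[Pg1 g10 [mu Mmu g1mu]] [Pg2 g20 d0 c10 gE]].
  exists (reflection dot a g1), (reflection dot a g2), d, c1, c2.
  rewrite !deg_r; split; split=> //; try exact: root_reflection.
    by exists mu => //; rewrite dot_r.
  by rewrite -!reflectionZ -reflectionD -gE reflectionZ reflectionK.
have [mu Mmu amu] := perpL a Pia La Ma.
have dega : deg a = 1.
  rewrite /deg outer_degree_simple //.
  by case: (boolP (a \in _)) => // /set_mem[].
have [n n0 nE] := cartan_nat Pa Pg ga.
have rE : reflection dot a g = g - n%:R *: a by rewrite /reflection nE.
have Pr := positive_sub psPsi Psir.
have degr := outer_degree_ge0 (L `|` M) Psir.
have [r0|r0] := ltP 0 (deg (reflection dot a g)).
  exists a, (reflection dot a g), 1%N, n, 1%N; rewrite dega; split; split=> //.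
    by exists mu.
  by rewrite rE !scale1r addrC subrK.
have {degr}r0 : deg (reflection dot a g) = 0 by apply/eqP; rewrite eq_le r0.
(* The [L] case is impossible: the reflected root would be orthogonal to [mu], but its pairing with
   [mu] is -n (a, mu). *)
have [rL|rM] := generated_of_outer_degree0 LPi MPi LM Pr r0.
  have : dot (reflection dot a g) mu = 0.
    by apply: (generated_subsystem_dot0 rsPhi _ LP rL) => l Ll; exact: LM.
  rewrite dot_reflection (g0 mu) // sub0r nE => /eqP.
  by rewrite oppr_eq0 mulf_eq0 pnatr_eq0 gtn_eqF //= (negPf amu).
set b := reflection dot a g in Pr r0 rM rE.
have bN0 := rootN0 rsPhi Pr.
have gb : dot g b = 0.
  by rewrite dotC; apply: (generated_subsystem_dot0 rsPhi _ MP rM) => m Mm;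
    rewrite dotC g0.
have bb := dot_gt0 dot bN0.
have gE : g = b + n%:R *: a by rewrite rE subrK.
have nab : n%:R * dot a b = - dot b b.
  move: gb; rewrite {1}gE dotDl dotZl => /eqP.
  by rewrite addrC addr_eq0 => /eqP.
have [d d0 dE] : exists2 d : nat, (0 < d)%N & 2 * dot (- a) b / dot b b = d%:R.
  apply: cartan_nat => //; first exact: (root_opp rsPhi).
  by rewrite linearNl oppr_gt0 -(@pmulr_rlt0 _ n%:R) ?ltr0n // nab oppr_lt0.
have sE : reflection dot b a = a + d%:R *: b.
  by rewrite /reflection -dE linearNl mulrN mulNr scaleNr.
exists a, (reflection dot b a), d, 1%N, 1%N; rewrite dega; split; split=> //.
- by exists mu.
- exact: root_reflection.
- by rewrite /deg outer_degree_reflection -/deg dega r0 mulr0 subr0.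
(* From n (a, b) = -(b, b) follows d n = 2, whence d g = 2 a + d b = a + (a + d b). *)
have dn : d%:R * n%:R = 2 :> R.
  rewrite -dE linearNl.
  have -> : 2 * - dot a b / dot b b * n%:R = 2 * - (n%:R * dot a b) / dot b b.
    by ring.
  by rewrite nab opprK mulfK ?gt_eqF.
rewrite sE !scale1r {1}gE scalerDr scalerA dn addrA -[2]/(1 + 1) scalerDl.
by rewrite !scale1r addrC.
Qed.

End SimpleSystems.

(** * Affine roots and their levels *)

Section AffineRoots.
Variables (R : realType) (V : vectType R) (dot : {dot V for idfun}).
Variables (Phi : set V) (rsPhi : root_system dot Phi).
Variables (Phip : set V) (psPhip : positive_system dot Phi Phip).
Implicit Types (a b g : V) (n m p : nat) (G A B : set (V * R^o)).

Definition affine_root a n : V * R^o := (a, n%:R).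

Lemma delta_level a n : embV a + n%:R *: delta V = affine_root a n.
Proof.
rewrite /embV /delta /affine_root; congr pair.
  by rewrite /= scaler0 addr0.
by rewrite /= add0r /GRing.scale /= mulr1.
Qed.

Lemma hat_affine_root a n : hat Phip a (affine_root a n) <->
  Phip a \/ Phip (- a) /\ (0 < n)%N.
Proof.
split=> [[k []] [Pa]|[Pa|[Pa n0]]].
- by left.
- by rewrite delta_level => -[/eqP]; rewrite eqr_nat => /eqP ->; right.
- by exists n; left; rewrite delta_level.
- by exists n.-1; right; rewrite delta_level prednK.
Qed.

Lemma hat_level a x : hat Phip a x -> exists n, x = affine_root a n.
Proof.
by move=> [n [] [_ ->]]; rewrite delta_level; [exists n|exists n.+1].
Qed.

Lemma affine_positive_root a n : affine_positive Phi Phip (affine_root a n) <->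
  Phi a /\ (Phip a \/ (0 < n)%N).
Proof.
split=> [[b Pb ab]|[Pa an]].
  have [k kE] := hat_level ab; have ba : b = a by case: kE.
  move: ab Pb; rewrite ba => /hat_affine_root[|[]]; auto.
exists a => //; apply/hat_affine_root.
by have [] := positive_or_opp rsPhi psPhip Pa; case: an; auto.
Qed.

Lemma affine_positiveP x : affine_positive Phi Phip x ->
  exists a n, x = affine_root a n.
Proof. by move=> [a _ /hat_level[n ->]]; exists a, n. Qed.

(** * Closed sets along strings of roots *)

Section Closed.
Variables (G : set (V * R^o)) (closedG : affine_closed Phi Phip G).

(** Only level zero needs an argument for the combination to be an affine positive root: there each
    summand has coefficient zero or level zero, and in the latter case its direction is in
    [Phip]. *)
Lemma closed_comb a b n m (k1 k2 : R) p :
  G (affine_root a n) -> G (affine_root b m) -> 0 <= k1 -> 0 <= k2 ->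
  Phi (k1 *: a + k2 *: b) -> k1 * n%:R + k2 * m%:R = p%:R ->
  G (affine_root (k1 *: a + k2 *: b) p).
Proof.
move: closedG => [Gap Gcl] Ga Gb k1_ge0 k2_ge0 Pab pE.
have rE : affine_root (k1 *: a + k2 *: b) p =
    k1 *: affine_root a n + k2 *: affine_root b m.
  by rewrite /affine_root -pE.
rewrite rE; apply: Gcl => //; rewrite -rE; apply/affine_positive_root.
split=> //; case: (posnP p) => [p0|]; last by right.
have side (k : R) c l : G (affine_root c l) -> k * l%:R = 0 ->
    k = 0 \/ Phip c.
  move=> /Gap/affine_positive_root[_ cl] /eqP; rewrite mulf_eq0 pnatr_eq0.
  by case/predU1P => [|/eqP l0]; [left|right; case: cl => //; rewrite l0].
move: pE; rewrite p0 => /eqP; rewrite paddr_eq0 ?mulr_ge0 //.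
move=> /andP[/eqP k1n /eqP k2m]; left.
by apply: (positive_cone psPhip) => //; [exact: side Ga k1n|exact: side Gb k2m].
Qed.

(** The two roots add up to (n + m) delta; adding k times this sum to the first raises its level to
    p when k = (p - n) / (n + m). *)
Lemma closed_opp a n m p : G (affine_root a n) -> G (affine_root (- a) m) ->
  (n <= p)%N -> G (affine_root a p).
Proof.
move=> Ga Gb np; pose k : R := (p - n)%:R / (n + m)%:R.
have [Pa an] := (affine_positive_root _ _).1 (closedG.1 _ Ga).
have [_ am] := (affine_positive_root _ _).1 (closedG.1 _ Gb).
(* The levels are not both zero, since [a] and [- a] are not both in [Phip]. *)
have nm0 : (n + m)%:R != 0 :> R.
  rewrite pnatr_eq0 addn_eq0; apply/negP => /andP[/eqP n0 /eqP m0].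
  move: an am; rewrite n0 m0 => -[|//] + [|//].
  exact: (positive_not_opp psPhip).
have k0 : 0 <= k by rewrite divr_ge0 // ler0n.
have aE : a = (1 + k) *: a + k *: - a.
  by rewrite scalerN scalerDl scale1r addrK.
rewrite [X in affine_root X]aE; apply: closed_comb Ga Gb _ _ _ _ => //.
- by rewrite addr_ge0.
- by rewrite -aE.
- rewrite mulrDl mul1r -addrA -mulrDr -natrD divfK //.
  by rewrite -natrD subnKC.
Qed.

Lemma closed_convex a n m p : G (affine_root a n) -> G (affine_root a m) ->
  (n <= p <= m)%N -> G (affine_root a p).
Proof.
move=> Gn Gm /andP[np pm].
have [nm|nm] := eqVneq n m.
  suff -> : p = n by [].
  by apply/eqP; rewrite eqn_leq np [X in (_ <= X)%N]nm pm.
have {}nm : (n < m)%N by rewrite ltn_neqAle nm (leq_trans np).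
have [Pa _] := (affine_positive_root _ _).1 (closedG.1 _ Gn).
pose k : R := (p - n)%:R / (m - n)%:R.
have mn0 : (0 : R) < (m - n)%:R by rewrite ltr0n subn_gt0.
have aE : a = (1 - k) *: a + k *: a by rewrite -scalerDl subrK scale1r.
rewrite [X in affine_root X]aE; apply: closed_comb Gn Gm _ _ _ _.
- by rewrite subr_ge0 ler_pdivrMr // mul1r ler_nat leq_sub2r.
- by rewrite divr_ge0 // ler0n.
- by rewrite -aE.
- rewrite /k !natrB ?(ltnW nm) //; move: mn0; rewrite natrB ?(ltnW nm) // => mn.
  by field; exact: lt0r_neq0.
Qed.

End Closed.

Lemma affine_positive_closed :
  affine_closed Phi Phip (affine_positive Phi Phip).
Proof. by split. Qed.

Lemma affine_closure_closed A : A `<=` affine_positive Phi Phip ->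
  affine_closed Phi Phip (affine_closure Phi Phip A).
Proof.
move=> AP; split.
  by apply: smallest_sub AP; exact: affine_positive_closed.
move=> x y k1 k2 xA yA k10 k20 xyP B AB; have [[_ Bcl] _] := AB.
by apply: Bcl => //; [exact: (xA B AB)|exact: (yA B AB)].
Qed.

Lemma mem_affine_closure A x : A x -> affine_closure Phi Phip A x.
Proof. exact: sub_smallest. Qed.

Lemma affine_closure_mono A B : A `<=` B ->
  affine_closure Phi Phip A `<=` affine_closure Phi Phip B.
Proof. by move=> AB x xA C [cC BC]; apply: xA; split=> // y /AB /BC. Qed.

(** The part of [G] in the string of [a] is an injective image of a set [B] of naturals, which is
    infinite exactly when it is unbounded. *)
Lemma infinite_rootsP G a : G `<=` affine_positive Phi Phip ->
  infinite_roots Phi Phip G a <->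
  Phi a /\ forall N, exists2 n, (N <= n)%N & G (affine_root a n).
Proof.
move=> GP; pose B := [set n | G (affine_root a n)].
have BE : hat Phip a `&` G = affine_root a @` B.
  apply/seteqP; split=> [x [/hat_level[n ->] Gx]|_ [n Gn <-]].
    by exists n.
  split=> //; apply/hat_affine_root.
  have [Pa an] := (affine_positive_root _ _).1 (GP _ Gn).
  by have [] := positive_or_opp rsPhi psPhip Pa; case: an; auto.
have Bcard : ((hat Phip a `&` G) #= [set: nat])%card = (B #= [set: nat])%card.
  rewrite BE; apply: card_eql; apply: inj_card_eq => n m _ _ [/eqP].
  by rewrite eqr_nat => /eqP.
rewrite /infinite_roots /= Bcard; split=> -[Pa Binf]; split=> //.
  move=> N; apply: contrapT => nex; apply: infinite_nat.
  rewrite -(eq_finite_set Binf); apply: sub_finite_set (finite_II N) => n Bn /=.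
  by rewrite ltnNge; apply/negP => Nn; apply: nex; exists n.
apply: eq_card_nat => // finB.
have [n nN Bn] := Binf (\max_(i <- fset_set B) i).+1.
have : (n <= \max_(i <- fset_set B) i)%N.
  by apply: leq_bigmax_seq => //; rewrite in_fset_set //; exact/mem_set.
by rewrite leqNgt nN.
Qed.

(** * Biclosed sets along strings of roots *)

Section Biclosed.
Variables (G : set (V * R^o)) (bG : biclosed Phi Phip G).

Lemma biclosed_infinite_roots_opp a n m :
  G (affine_root a n) -> G (affine_root (- a) m) ->
  infinite_roots Phi Phip G a.
Proof.
move=> Gn Gm; apply/infinite_rootsP; first exact: bG.1.1.
split; first by have [] := (affine_positive_root _ _).1 (bG.1.1 _ Gn).
move=> N; exists (maxn N n); first exact: leq_maxl.
by apply: (closed_opp bG.1) Gn Gm _; exact: leq_maxr.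
Qed.

Lemma biclosed_full_hat a n : infinite_roots Phi Phip G a ->
  ~ infinite_roots Phi Phip G (- a) -> (Phip a \/ (0 < n)%N) ->
  G (affine_root a n).
Proof.
have GP := bG.1.1.
move=> /(infinite_rootsP _ GP)[Pa aI] /(infinite_rootsP _ GP) naI an.
have PNa := root_opp rsPhi Pa.
have [N NG] : exists N, forall n, (N <= n)%N -> ~ G (affine_root (- a) n).
  apply: contrapT => nex; apply: naI; split=> // N.
  apply: contrapT => nG; apply: nex; exists N => k Nk Gk; apply: nG.
  by exists k.
apply: contrapT => nGa; have [k nk Gk] := aI n.
(* Level [N.+1] is positive, hence admissible for [- a] whatever its sign. *)
have := @closed_opp _ bG.2 a n N.+1 k; case=> //.
- by split=> //; exact/affine_positive_root.
- split; first by apply/affine_positive_root; auto.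
  by apply: NG.
Qed.

(** A level of [- a] in [G], together with one of [a], would yield all higher levels of [- a]. *)
Lemma biclosed_empty_hat a n : infinite_roots Phi Phip G a ->
  ~ infinite_roots Phi Phip G (- a) -> ~ G (affine_root (- a) n).
Proof.
have GP := bG.1.1.
move=> /(infinite_rootsP _ GP)[Pa aI] naI Gn; apply: naI.
have [m _ Gm] := aI 0%N.
by apply: (biclosed_infinite_roots_opp Gn); rewrite opprK; exact: Gm.
Qed.

End Biclosed.

End AffineRoots.

Lemma finite_set_ubound (F : realDomainType) (T : choiceType) (A : set T)
  (f : T -> F) : finite_set A -> exists K, forall x, A x -> f x <= K.
Proof.
move=> finA; exists (\sum_(x <- fset_set A) `|f x|) => x Ax.
rewrite (big_fsetD1 x) /=; last by rewrite in_fset_set //; exact/mem_set.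
by rewrite (le_trans (ler_norm _)) // lerDl sumr_ge0.
Qed.

(** * Biclosed sets with prescribed infinite roots *)

Section BiclosedLM.
Variables (R : realType) (V : vectType R) (dot : {dot V for idfun}).
Variables (Phi Phip Psi Pi L M : set V) (Gamma : set (V * R^o)).
Hypothesis rsPhi : root_system dot Phi.
Hypothesis crPhi : crystallographic dot Phi.
Hypothesis psPhip : positive_system dot Phi Phip.
Hypothesis psPsi : positive_system dot Phi Psi.
Hypothesis ssPi : simple_system Psi Pi.
Hypothesis MPi : M `<=` Pi.
Hypothesis LPi : L `<=` Pi.
Hypothesis LM : orthogonal_sets dot L M.
Hypothesis bG : biclosed Phi Phip Gamma.
Hypothesis IG : infinite_roots Phi Phip Gamma = positive_LM dot Phi Psi L M.

Implicit Types (a b g mu : V) (n m : nat) (A : set (V * R^o)).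

Let PiPhi : Pi `<=` Phi := simple_root psPsi ssPi.
Let MPhi : M `<=` Phi := subset_trans MPi PiPhi.
Let deg := outer_degree Pi (L `|` M).

Let generated_degL g : generated_subsystem dot Phi L g -> deg g = 0.
Proof. by apply: (generated_outer_degree rsPhi psPsi ssPi) => // x; left. Qed.

Let generated_degM g : generated_subsystem dot Phi M g -> deg g = 0.
Proof. by apply: (generated_outer_degree rsPhi psPsi ssPi) => // x; right. Qed.

Let generated_oppM g :
  generated_subsystem dot Phi M g -> generated_subsystem dot Phi M (- g).
Proof.
move=> gM; apply: (root_subsystem_opp rsPhi _ gM).
exact: (generated_root_subsystem rsPhi MPhi).
Qed.

(** Roots of nonzero [deg] lie in neither generated subsystem, so only their sign decides membership
    in [positive_LM]. *)
Lemma infinite_root_deg g : Phi g -> 0 < deg g ->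
  infinite_roots Phi Phip Gamma g /\ ~ infinite_roots Phi Phip Gamma (- g).
Proof.
move=> Pg dg; rewrite IG.
have Psig := outer_degree_gt0 rsPhi psPsi ssPi Pg dg.
split.
  by left; split=> // /generated_degL dg0; rewrite dg0 ltxx in dg.
case=> [[/(positive_not_opp psPsi)]|]; first by rewrite opprK; exact.
by move=> /generated_oppM /generated_degM; rewrite opprK => dg0;
  rewrite dg0 ltxx in dg.
Qed.

(** At degree zero the root is generated by [L], which [positive_LM] removes, or by [M], whose
    subsystem contains opposites. *)
Lemma deg_infinite_root g : infinite_roots Phi Phip Gamma g ->
  ~ infinite_roots Phi Phip Gamma (- g) -> 0 < deg g.
Proof.
rewrite IG => Ig nIg.
have nM : ~ generated_subsystem dot Phi M g.
  by move=> /generated_oppM Mg; apply: nIg; right.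
case: Ig => [[Psig nL]|//].
rewrite lt_neqAle eq_sym (outer_degree_ge0 rsPhi psPsi ssPi) // andbT.
apply/eqP => dg; have Pg := positive_sub psPsi Psig.
by have [] := generated_of_outer_degree0 rsPhi psPsi ssPi LPi MPi LM Pg dg.
Qed.

(** Level zero is left out because it is an affine root only for directions in [Phip]. *)
Lemma full_hat_deg g n : Phi g -> 0 < deg g -> (0 < n)%N ->
  Gamma (affine_root g n).
Proof.
move=> Pg /(infinite_root_deg Pg)[Ig nIg] n0.
by apply: (biclosed_full_hat rsPhi psPhip bG) => //; right.
Qed.

(** * Finite generation for maximal L *)

Section FinitelyGenerated.
Local Notation closure := (affine_closure Phi Phip).

Let ambient A : A `<=` Gamma -> A `<=` affine_positive Phi Phip.
Proof. by move=> AG x /AG; exact: bG.1.1. Qed.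

Let closure_sub A : A `<=` Gamma -> closure A `<=` Gamma.
Proof. by move=> AG; apply: smallest_sub => //; exact: bG.1. Qed.

Definition finitely_unbounded g := exists A,
  [/\ finite_set A, A `<=` Gamma &
      forall N, exists2 n, (N <= n)%N & closure A (affine_root g n)].

(** The union of such sets over the finitely many roots generates [Gamma]. *)
Definition finitely_covered g := exists A,
  [/\ finite_set A, A `<=` Gamma &
      forall n, Gamma (affine_root g n) -> closure A (affine_root g n)].

(* Adding the root of lowest level makes every other one lie between two levels
   that are already reached. *)
Lemma finitely_unbounded_covered g :
  finitely_unbounded g -> finitely_covered g.
Proof.
move=> [A [finA AG unbA]].
have exG : exists n, `[< Gamma (affine_root g n) >].
  have [n _ An] := unbA 0%N; exists n; apply/asboolP.
  exact: (closure_sub AG).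
case: (ex_minnP exG) => n0 /asboolP Gn0 n0min.
exists (affine_root g n0 |` A); split.
- by rewrite finite_setU; split=> //; exact: finite_set1.
- by move=> x [->|/AG].
move=> n Gn; have [m nm Am] := unbA n.
have AG' : affine_root g n0 |` A `<=` Gamma by move=> x [->|/AG].
apply: (closed_convex rsPhi psPhip
  (affine_closure_closed (ambient AG')) (n := n0) (m := m)).
- by apply: mem_affine_closure => //; left.
- by apply: affine_closure_mono Am => x; right.
- by rewrite nm andbT n0min //; exact/asboolP.
Qed.

(** One root in each of the two opposite directions suffices: their sum is a positive multiple of
    delta. *)
Lemma finitely_unbounded_opp g : infinite_roots Phi Phip Gamma g ->
  infinite_roots Phi Phip Gamma (- g) -> finitely_unbounded g.
Proof.
have GP := bG.1.1.
move=> /(infinite_rootsP rsPhi psPhip _ GP)[_ /(_ 0%N)[n _ Gn]].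
move=> /(infinite_rootsP rsPhi psPhip _ GP)[_ /(_ 0%N)[m _ Gm]].
have AG : [set affine_root g n; affine_root (- g) m] `<=` Gamma.
  by move=> x [->|->].
exists [set affine_root g n; affine_root (- g) m]; split=> // N.
exists (maxn N n); first exact: leq_maxl.
apply: (closed_opp rsPhi psPhip (affine_closure_closed (ambient AG))
  (n := n) (m := m) (p := maxn N n)); last exact: leq_maxr.
- by apply: mem_affine_closure => //; left.
- by apply: mem_affine_closure => //; right.
Qed.

Lemma finitely_unbounded_nonorthogonal g mu : Phi g -> 0 < deg g ->
  M mu -> dot g mu != 0 -> finitely_unbounded g.
Proof.
move=> Pg dg Mmu gmu.
have GMmu : generated_subsystem dot Phi M mu.
  exact: (sub_smallest (@subset_refl _ M) Mmu).
have [s [Ms gs]] : exists s, generated_subsystem dot Phi M s /\ 0 < dot g s.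
  have [gp|gn] := ltP 0 (dot g mu); first by exists mu.
  exists (- mu); split; first exact: generated_oppM.
  by rewrite linearNr oppr_gt0 lt_neqAle gmu.
have Ps : Phi s := (generated_root_subsystem rsPhi MPhi).1 _ Ms.
have Is : infinite_roots Phi Phip Gamma s by rewrite IG; right.
have INs : infinite_roots Phi Phip Gamma (- s).
  by rewrite IG; right; exact: generated_oppM.
have [A [finA AG unbA]] := finitely_unbounded_opp Is INs.
have [c c0 cE] := cartan_nat rsPhi crPhi Ps Pg gs.
set r := reflection dot s g.
have gE : g = 1 *: r + c%:R *: s by rewrite /r /reflection cE scale1r subrK.
have Gr : Gamma (affine_root r 1).
  apply: full_hat_deg => //; first exact: (root_reflection rsPhi).
  rewrite /deg outer_degree_reflection [X in _ * X]generated_degM //.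
  by rewrite mulr0 subr0.
have AG' : affine_root r 1 |` A `<=` Gamma by move=> x [->|/AG].
exists (affine_root r 1 |` A); split=> //.
  by rewrite finite_setU; split=> //; exact: finite_set1.
move=> N; have [n Nn An] := unbA N.
(* Level 1 of [r], which has the degree of [g], plus [c] times level [n] of [s]. *)
exists (1 + c * n)%N.
  by rewrite (leq_trans Nn) // (leq_trans _ (leq_addl _ _)) // leq_pmull.
rewrite [X in affine_root X (_ + _)%N]gE.
apply: (closed_comb rsPhi psPhip (affine_closure_closed (ambient AG'))
  (n := 1) (m := n)) => //.
- by apply: mem_affine_closure => //; left.
- by apply: affine_closure_mono An => x; right.
- by rewrite -gE.
- by rewrite mul1r natrD natrM.
Qed.

Hypothesis Lmax : simple_perp dot Pi M `<=` L.

Lemma finitely_unbounded_deg g : Phi g -> 0 < deg g -> finitely_unbounded g.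
Proof.
move=> Pg dg.
have [[mu Mmu gmu]|gM] := pselect (exists2 mu, M mu & dot g mu != 0).
  exact: finitely_unbounded_nonorthogonal Mmu gmu.
have g0 mu : M mu -> dot g mu = 0.
  by move=> Mmu; apply: contrapT => /eqP gmu; apply: gM; exists mu.
have perpL a : Pi a -> ~ L a -> ~ M a -> exists2 mu, M mu & dot a mu != 0.
  move=> Pia La _; apply: contrapT => nex; apply: La; apply: Lmax; split=> //.
  by move=> mu Mmu; apply: contrapT => /eqP amu; apply: nex; exists mu.
have [g1 [g2 [d [c1 [c2]]]]] := orthogonal_root_decomposition rsPhi psPsi ssPi
  crPhi LPi MPi LM perpL (outer_degree_gt0 rsPhi psPsi ssPi Pg dg) dg g0.
move=> [[Pg1 dg1 [mu Mmu g1mu]] [Pg2 dg2 d0 c10 gE]].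
(* Unboundedness of [g1] would not do: its level must be divisible by [d], so all its levels have to
   be covered. *)
have [A [finA AG covA]] := finitely_unbounded_covered
  (finitely_unbounded_nonorthogonal Pg1 dg1 Mmu g1mu).
have Gg2 : Gamma (affine_root g2 d) by exact: full_hat_deg.
have AG' : affine_root g2 d |` A `<=` Gamma by move=> x [->|/AG].
exists (affine_root g2 d |` A); split=> //.
  by rewrite finite_setU; split=> //; exact: finite_set1.
move=> N.
(* Take [g1] at level d (N + 1) and [g2] at level d, then divide the combination by d. *)
exists (c1 * N.+1 + c2)%N.
  rewrite (leq_trans _ (leq_addr _ _)) // (leq_trans (leqnSn N)) //.
  by rewrite leq_pmull.
have dN0 : d%:R != 0 :> R by rewrite pnatr_eq0 -lt0n.
have {}gE : g = (c1%:R / d%:R) *: g1 + (c2%:R / d%:R) *: g2.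
  apply: (scalerI dN0).
  by rewrite gE scalerDr !scalerA !(mulrC d%:R) !divfK.
rewrite [X in affine_root X (_ + _)%N]gE.
apply: (closed_comb rsPhi psPhip (affine_closure_closed (ambient AG'))
  (n := d * N.+1) (m := d)).
- apply: affine_closure_mono (covA (d * N.+1)%N _); first by move=> x; right.
  by apply: full_hat_deg => //; rewrite muln_gt0 d0.
- by apply: mem_affine_closure => //; left.
- by rewrite divr_ge0 ?ler0n.
- by rewrite divr_ge0 ?ler0n.
- by rewrite -gE.
- by rewrite natrD !natrM; field.
Qed.

(** A direction with finitely many levels in [Gamma] is covered by those roots themselves. An
    infinite one either has an infinite opposite or has positive degree. *)
Lemma finitely_covered_root g : Phi g -> finitely_covered g.
Proof.
move=> Pg; have GP := bG.1.1.
have [Ig|nIg] := pselect (infinite_roots Phi Phip Gamma g); last first.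
  have [N NG] : exists N, forall n, Gamma (affine_root g n) -> (n < N)%N.
    apply: contrapT => nex; apply: nIg.
    apply/(infinite_rootsP rsPhi psPhip _ GP); split=> // N.
    apply: contrapT => nG; apply: nex; exists N => n Gn.
    by rewrite ltnNge; apply/negP => Nn; apply: nG; exists n.
  exists (Gamma `&` (affine_root g @` `I_N)); split.
  - exact/finite_setIr/finite_image/finite_II.
  - exact: subIsetl.
  - move=> n Gn; apply: mem_affine_closure; split=> //.
    by exists n => //=; exact: NG.
apply: finitely_unbounded_covered.
have [INg|nINg] := pselect (infinite_roots Phi Phip Gamma (- g)).
  exact: finitely_unbounded_opp.
exact/finitely_unbounded_deg/deg_infinite_root.
Qed.

Lemma perp_finitely_generated : finitely_generated Phi Phip Gamma.
Proof.
have /choice[A_ A_P] : forall g, exists A, Phi g ->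
    [/\ finite_set A, A `<=` Gamma &
      forall n, Gamma (affine_root g n) -> closure A (affine_root g n)].
  move=> g; have [/finitely_covered_root[A AP]|nP] := pselect (Phi g).
    by exists A.
  by exists set0.
have AG : \bigcup_(g in Phi) A_ g `<=` Gamma.
  by move=> x [g Pg]; have [_ + _] := A_P g Pg; apply.
exists (\bigcup_(g in Phi) A_ g); split.
- apply: bigcup_finite => [|g Pg]; first exact: root_finite rsPhi.
  by have [] := A_P g Pg.
- exact: ambient.
apply/seteqP; split; last exact: closure_sub.
move=> x Gx; have [g [n xE]] := affine_positiveP (bG.1.1 _ Gx).
rewrite xE in Gx *.
have [Pg _] := (affine_positive_root rsPhi psPhip _ _).1 (bG.1.1 _ Gx).
have [_ _ covA] := A_P g Pg.
by apply: affine_closure_mono (covA _ Gx) => y Ay; exists g.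
Qed.

End FinitelyGenerated.

(** * Failure of finite generation for smaller L *)

Section NotFinitelyGenerated.
Variable beta : V.
Hypothesis Pibeta : Pi beta.
Hypothesis beta_perp : forall mu, M mu -> dot beta mu = 0.
Hypothesis betaL : ~ L beta.

Let S : set V := beta |` L.
Let SPi : S `<=` Pi. Proof. by move=> a [->|/LPi]. Qed.
Let SPhi : S `<=` Phi := subset_trans SPi PiPhi.
Let SM : orthogonal_sets dot S M.
Proof. by move=> a mu [->|La] Mmu; [exact: beta_perp|exact: LM]. Qed.
Let degS := outer_degree Pi (S `|` M).
Let genS_genM0 := generated_subsystem_orthogonal rsPhi SPhi MPhi SM.

Let genSM0 a : Phi a -> generated_subsystem dot Phi S a ->
  generated_subsystem dot Phi M a -> False.
Proof.
move=> Pa aS aM; have := dot_gt0 dot (rootN0 rsPhi Pa).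
by rewrite genS_genM0 ?ltxx.
Qed.

Let betaM : ~ M beta.
Proof.
move=> /beta_perp /dot_self_eq0 b0; have := rootN0 rsPhi (PiPhi Pibeta).
by rewrite b0 eqxx.
Qed.

(** [Gamma] misses the strings of the roots of negative [deg]. A negative root of degree zero is
    generated by [M] or by [L], hence by [S]. *)
Lemma root_of_biclosed a n : Gamma (affine_root a n) ->
  0 < degS a \/ generated_subsystem dot Phi M a \/
  generated_subsystem dot Phi S a.
Proof.
move=> Gan.
have [Pa _] := (affine_positive_root rsPhi psPhip _ _).1 (bG.1.1 _ Gan).
have [Psia|Psia] := positive_or_opp rsPhi psPsi Pa.
  have := outer_degree_ge0 rsPhi psPsi ssPi (S `|` M) Psia.
  rewrite le_eqVlt => /predU1P[a0|]; last by left.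
  right; have [] := generated_of_outer_degree0 rsPhi psPsi ssPi SPi MPi SM Pa;
    auto.
right; have PNa := positive_sub psPsi Psia.
have := outer_degree_ge0 rsPhi psPsi ssPi (L `|` M) Psia.
rewrite le_eqVlt => /predU1P[a0|dega].
  have := generated_of_outer_degree0 rsPhi psPsi ssPi LPi MPi LM Pa.
  have -> : outer_degree Pi (L `|` M) a = 0.
    by apply/eqP; rewrite -oppr_eq0 -outer_degreeN -a0.
  case=> // aG; [right|by left].
  by apply: generated_subsystem_mono aG => x; right.
have [INa nIa] := infinite_root_deg PNa dega.
by have := biclosed_empty_hat rsPhi psPhip bG INa nIa (n := n); rewrite opprK.
Qed.

(* The bound cuts out the set [C] below, which is closed because [S] and [M] are
   orthogonal: no positive combination of a root generated by [S] and one
   generated by [M] is a root. *)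
Lemma not_finitely_generated : ~ finitely_generated Phi Phip Gamma.
Proof.
move=> [A [finA AP GA]].
have AG : A `<=` Gamma by rewrite GA => x Ax; exact: mem_affine_closure.
pose P := [set a | generated_subsystem dot Phi S a /\
                   exists n, Gamma (affine_root a n)].
have [genSPhi genSr] := generated_root_subsystem rsPhi SPhi.
have [v vP] : exists v, forall a, P a -> 0 < dot a v.
  apply: (dot_pos_sum rsPhi) => [a [/genSPhi]//|a [aS [n Gn]] [naS [m Gm]]|].
    (* If [a] and [- a] both occurred, both would be infinite roots; orthogonality to [M] puts both
       in [Psi]. *)
    have := biclosed_infinite_roots_opp rsPhi psPhip bG Gn Gm.
    have := biclosed_infinite_roots_opp rsPhi psPhip bG Gm.
    rewrite opprK => /(_ _ Gn); rewrite IG.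
    case=> [[Psina _]|naM]; last by case: (genSM0 (genSPhi _ naS) naS naM).
    case=> [[Psia _]|aM]; last by case: (genSM0 (genSPhi _ aS) aS aM).
    exact: (positive_not_opp psPsi Psia).
  move=> g q [gS [n Gg]] [qS [m Gq]] qg; split; first exact: genSr.
  have Pg := genSPhi _ gS; have Pq := genSPhi _ qS.
  have [c c0 cE] : exists2 c : nat, (0 < c)%N &
      2 * dot (- q) g / dot g g = c%:R.
    apply: (cartan_nat rsPhi crPhi) => //; first exact: (root_opp rsPhi).
    by rewrite linearNl oppr_gt0.
  (* The reflected root is a nonnegative combination of two directions of [P], so it occurs in
     [Gamma] at level m + c n. *)
  have rE : reflection dot g q = 1 *: q + c%:R *: g.
    by rewrite /reflection -cE linearNl scale1r mulrN mulNr scaleNr.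
  exists (m + c * n)%N; rewrite rE.
  apply: (closed_comb rsPhi psPhip bG.1 Gq Gg) => //.
  - by rewrite -rE; exact: (root_reflection rsPhi).
  - by rewrite mul1r natrD natrM.
(* The quotient is read only for directions in [P], where the pairing with [v] is positive. *)
have [K KA] :=
  finite_set_ubound (fun x : V * R^o => (x.2 : R) / dot x.1 v) finA.
pose C := [set x | affine_positive Phi Phip x /\
  (0 < degS x.1 \/ generated_subsystem dot Phi M x.1 \/
   generated_subsystem dot Phi S x.1 /\ x.2 <= K * dot x.1 v :> R)].
have AC : A `<=` C.
  move=> x Ax; have xP := AP _ Ax; split=> //.
  have [a [n xE]] := affine_positiveP xP.
  have := AG _ Ax; rewrite {1}xE => Gan.
  have [|[|aS]] := root_of_biclosed Gan; rewrite xE; [by left|by right; left|].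
  right; right; split=> //=.
  rewrite -ler_pdivrMr; last by apply: vP; split=> //; exists n.
  by have := KA _ Ax; rewrite xE.
have degS_ge0 x : C x -> 0 <= degS x.1.
  move=> [_ [/ltW //|[xM|[xS _]]]].
    by rewrite /degS (generated_outer_degree rsPhi psPsi ssPi MPi _ xM).
  by rewrite /degS (generated_outer_degree rsPhi psPsi ssPi SPi _ xS).
have rootP x : affine_positive Phi Phip x -> Phi x.1.
  move=> xP; have [a [n xE]] := affine_positiveP xP; move: xP; rewrite xE.
  by move=> /(affine_positive_root rsPhi psPhip)[].
(* When one coefficient is zero, reducedness forces the other to be 1. *)
have degenerate (k : R) x : 0 <= k -> C x ->
    affine_positive Phi Phip (k *: x) -> C (k *: x).
  move=> k0 Cx /rootP /= Pkx; have Px := rootP _ Cx.1.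
  have [->|k1] := root_reduced rsPhi Px Pkx; first by rewrite scale1r.
  by move: k0; rewrite k1 ler0N1.
have closedC : affine_closed Phi Phip C.
  split=> [x []//|x y k1 k2 Cx Cy k1_ge0 k2_ge0 zP].
  have [k10|k1N0] := eqVneq k1 0.
    by move: zP; rewrite k10 scale0r add0r; exact: degenerate.
  have [k20|k2N0] := eqVneq k2 0.
    by move: zP; rewrite k20 scale0r addr0; exact: degenerate.
  have k1_gt0 : 0 < k1 by rewrite lt_neqAle eq_sym k1N0.
  have k2_gt0 : 0 < k2 by rewrite lt_neqAle eq_sym k2N0.
  split=> //; have Pz := rootP _ zP.
  have zE : degS (k1 *: x + k2 *: y).1 = k1 * degS x.1 + k2 * degS y.1.
    by rewrite /degS /= outer_degreeD !outer_degreeZ.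
  have [zdeg|zdeg] := ltP 0 (degS (k1 *: x + k2 *: y).1); first by left.
  right; have z0 : k1 * degS x.1 + k2 * degS y.1 == 0.
    by rewrite eq_le -zE zdeg zE addr_ge0 // mulr_ge0 // degS_ge0.
  move: (z0); rewrite paddr_eq0 ?mulr_ge0 ?degS_ge0 // !mulf_eq0.
  rewrite (negPf k1N0) (negPf k2N0) /= => /andP[/eqP x0 /eqP y0].
  have zG : generated_subsystem dot Phi S (k1 *: x + k2 *: y).1 \/
            generated_subsystem dot Phi M (k1 *: x + k2 *: y).1.
    apply: (generated_of_outer_degree0 rsPhi psPsi ssPi SPi MPi SM Pz).
    by rewrite -/degS zE; exact/eqP.
  have dx := dot_gt0 dot (rootN0 rsPhi (rootP _ Cx.1)).
  have dy := dot_gt0 dot (rootN0 rsPhi (rootP _ Cy.1)).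
  have dz := dot_gt0 dot (rootN0 rsPhi Pz).
  have zl u : dot (k1 *: x + k2 *: y).1 u = k1 * dot x.1 u + k2 * dot y.1 u.
    by rewrite /= dotDl !dotZl.
  case: Cx => _ [|]; rewrite ?x0 ?ltxx // => Cx.
  case: Cy => _ [|]; rewrite ?y0 ?ltxx // => Cy.
  case: zG => [zS|zM]; last by left.
  right; split=> //.
  (* A summand generated by [M] is orthogonal to the combination, which is generated by [S]; this
     contradicts positivity of the form. If both summands are generated by [S], their bounds add
     up. *)
  case: Cx => [xM|[xS xK]]; case: Cy => [yM|[yS yK]].
  - have zM u : generated_subsystem dot Phi M u ->
        dot u (k1 *: x + k2 *: y).1 = 0.
      by move=> uM; rewrite dotC; exact: genS_genM0.
    by move: dz; rewrite zl !zM // !mulr0 addr0 ltxx.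
  - move: (genS_genM0 zS xM); rewrite zl (genS_genM0 yS xM) mulr0 addr0.
    by move=> /eqP; rewrite mulf_eq0 (negPf k1N0) gt_eqF.
  - move: (genS_genM0 zS yM); rewrite zl (genS_genM0 xS yM) mulr0 add0r.
    by move=> /eqP; rewrite mulf_eq0 (negPf k2N0) gt_eqF.
  - by rewrite zl /= mulrDr !(mulrCA K) lerD // ler_wpM2l.
have Pb := PiPhi Pibeta.
have degb : 0 < deg beta.
  rewrite /deg (outer_degree_simple rsPhi psPsi ssPi) //.
  by case: (boolP (beta \in _)) => // /set_mem[].
have bG' n : C (affine_root beta n.+1).
  suff: Gamma (affine_root beta n.+1) by rewrite GA; apply: smallest_sub.
  exact: full_hat_deg.
(* The integer part plus one exceeds K (beta, v). The other alternatives fail because [beta] is in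
   [S] and not in [M]. *)
have [_ [|[bM|[_]]]] := bG' (Num.truncn `|K * dot beta v|).
- rewrite /degS (outer_degree_simple rsPhi psPsi ssPi) // mem_set ?ltxx //.
  by left; left.
- have := outer_degree_simple rsPhi psPsi ssPi M Pibeta.
  rewrite (generated_outer_degree rsPhi psPsi ssPi MPi _ bM) //.
  by case: (boolP (beta \in _)) => [/set_mem|_ /esym/eqP]; rewrite ?oner_eq0.
- rewrite /= leNgt => /negP; apply; apply: le_lt_trans (ler_norm _) _.
  exact: truncnS_gt.
Qed.

End NotFinitelyGenerated.

End BiclosedLM.

Theorem theorem5p2 (R : realType) (V : vectType R) (dot : {dot V for idfun})
    (Phi Phip Psip Pi M : set V) :
  root_system dot Phi -> crystallographic dot Phi -> irreducible dot Phi ->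
  positive_system dot Phi Phip ->
  positive_system dot Phi Psip -> simple_system Psip Pi ->
  M `<=` Pi ->
  (forall L : set V, L = simple_perp dot Pi M ->
     forall Gamma : set (V * R^o), biclosed Phi Phip Gamma ->
       infinite_roots Phi Phip Gamma = positive_LM dot Phi Psip L M ->
       finitely_generated Phi Phip Gamma) /\
  (forall L : set V, L `<` simple_perp dot Pi M ->
     forall Gamma : set (V * R^o), biclosed Phi Phip Gamma ->
       infinite_roots Phi Phip Gamma = positive_LM dot Phi Psip L M ->
       ~ finitely_generated Phi Phip Gamma).
Proof.
move=> rsPhi crPhi _ psPhip psPsi ssPi MPi.
split=> [L -> Gamma bG IG|L [Lperp nperpL] Gamma bG IG].
  apply: (perp_finitely_generated rsPhi crPhi psPhip psPsi ssPi MPi _ _ bG IG).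
  - by move=> a [].
  - by move=> a mu [_]; apply.
  - by [].
have [beta [Pibeta beta_perp] betaL] :
    exists2 beta, simple_perp dot Pi M beta & ~ L beta.
  apply: contrapT => nex; apply: nperpL => a aM; apply: contrapT => aL.
  by apply: nex; exists a.
apply: (not_finitely_generated rsPhi crPhi psPhip psPsi ssPi MPi _ _ bG IG
  Pibeta) => //.
- by move=> a /Lperp[].
- by move=> a mu /Lperp[_]; apply.
Qed.
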